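(* Let $D=\{0,1\}$ with the order $1<0$. Then the set $\varGamma_{\mathrm{SNF}}$ of all safely NAND-free relations on $\{0,1\}$ equals $\mathrm{Inv}(M_{D,\le})$, the set of all relations on $\{0,1\}$ invariant under $M_{D,\le}$.
   Context: For an $r$-ary relation $R$ on $\{0,1\}$ and $0<k<r$, a relation $R'(x_1,\dots,x_{r-k})=R(\xi_1,\dots,\xi_r)$ with each $\xi_j\in\{x_1,\dots,x_{r-k}\}\cup\{0,1\}$ is obtained from $R$ by substitution of constants if each variable occurs at most once among the $\xi_j$, and by identification of variables if every $\xi_j$ is a variable. $R$ is NAND-free if $\mathrm{NAND}=\{(0,0),(0,1),(1,0)\}$ cannot be obtained from $R$ by substitution of constants; $R$ is safely NAND-free if $R$ and every relation obtained from $R$ by identification of variables are NAND-free. For a finite totally ordered set $(D,\le)$, $M_{D,\le}$ is the ternary partial operation with $M_{D,\le}(x,y,y)=M_{D,\le}(y,y,x)=x$ whenever $x\le y$, undefined otherwise; here (with $1<0$): $M(0,0,0)=0$, $M(1,0,0)=M(0,0,1)=M(1,1,1)=1$, undefined otherwise. A partial operation acts on tuples coordinatewise (defined iff all coordinates are defined); a relation is invariant under it if every defined result of applying it to tuples of the relation lies in the relation.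
   Formalization: NAND itself is declared not NAND-free (the empty substitution k=0 is allowed in the definition of NAND-free); with only 0<k<r, NAND would be safely NAND-free although it is not invariant under M. *)

(* Defs.v *)
From mathcomp Require Import all_boot all_order.
From mathcomp Require Import boolp classical_sets.

Set Implicit Arguments.
Unset Strict Implicit.
Unset Printing Implicit Defensive.

Local Open Scope classical_set_scope.

Record relation (D : Type) := Relation {
  arity : nat;
  graph : set (arity.-tuple D)
}.
Arguments graph {D} r.

(* In [bool], [false] is 0 and [true] is 1. *)

(* The value of an argument [xi], which is a variable among x_1, ..., x_s or
   a constant, under the assignment [x] of the variables. *)
Definition arg_val s (x : s.-tuple bool) (xi : 'I_s + bool) : bool :=
  match xi with inl v => tnth x v | inr c => c end.

(* R'(x_1, ..., x_s) = R(xi_1, ..., xi_r). *)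
Definition instance (R : relation bool) s (xi : 'I_(arity R) -> 'I_s + bool) :
    relation bool :=
  Relation
    [set x : s.-tuple bool | graph R [tuple arg_val x (xi j) | j < arity R]].

Definition by_substitution (R R' : relation bool) : Prop :=
  exists (k : nat) (xi : 'I_(arity R) -> 'I_(arity R - k) + bool),
    [/\ 0 < k < arity R,
        forall v i j, xi i = inl v -> xi j = inl v -> i = j
      & R' = instance xi].

Definition by_identification (R R' : relation bool) : Prop :=
  exists (k : nat) (xi : 'I_(arity R) -> 'I_(arity R - k) + bool),
    [/\ 0 < k < arity R,
        forall j, exists v, xi j = inl v
      & R' = instance xi].

Definition NAND : relation bool :=
  Relation [set [tuple false; false]; [tuple false; true]; [tuple true; false]].

(* [by_substitution] replaces at least one argument; the empty substitution,
   which yields R itself, has to be excluded separately, so that NAND is not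
   NAND-free. *)
Definition nand_free (R : relation bool) : Prop :=
  R <> NAND /\ ~ by_substitution R NAND.

Definition safely_nand_free (R : relation bool) : Prop :=
  nand_free R /\ forall R', by_identification R R' -> nand_free R'.

Definition Gamma_SNF : set (relation bool) := [set R | safely_nand_free R].

(* [None] stands for "undefined". *)
Definition partial_op3 (D : Type) := D -> D -> D -> option D.

Definition invariant3 (D : Type) (f : partial_op3 D) (R : relation D) : Prop :=
  forall a b c d : (arity R).-tuple D,
    graph R a -> graph R b -> graph R c ->
    (forall i, f (tnth a i) (tnth b i) (tnth c i) = Some (tnth d i)) ->
    graph R d.

Definition Inv (D : Type) (f : partial_op3 D) : set (relation D) :=
  [set R | invariant3 f R].

(* M(x, y, y) = M(y, y, x) = x for x <= y.  The two clauses overlap only at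
   M(x, x, x), where they agree. *)
Definition M_op (disp : Order.disp_t) (D : finOrderType disp) : partial_op3 D :=
  fun a b c =>
    if (b == c) && (a <= b)%O then Some a
    else if (a == b) && (c <= b)%O then Some c
    else None.

Arguments M_op {disp} D.

(* Main.v *)
(** Writing tuples of bits as sets, M(a, b, c) is defined exactly when
    b = a ∩ c, and its value is then a ∪ c. Hence R is invariant iff
    a, c, a ∩ c ∈ R imply a ∪ c ∈ R. This property passes to every instance of
    R and fails for NAND, so invariant relations are safely NAND-free.
    Conversely, if a, c, a ∩ c ∈ R but a ∪ c ∉ R, identify any two
    coordinates i, j with a_i = a_j and c_i = c_j. Afterwards at most
    one coordinate lies in a \ c and at most one in c \ a; keeping these as
    variables and fixing each remaining coordinate to its common value in a and c yields NAND. *)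
Require Import Defs.
From mathcomp Require Import all_boot all_order.
From mathcomp Require Import boolp classical_sets.

Set Implicit Arguments.
Unset Strict Implicit.
Unset Printing Implicit Defensive.

Lemma M_op_dual_boolP (x y z w : bool) :
  M_op (bool^d)%type x y z = Some w <-> y = x && z /\ w = x || z.
Proof. by case: x y z w => [] [] [] []; split=> // -[]. Qed.

Lemma invariant3_M_op_dual_boolP (R : relation bool) :
  invariant3 (M_op (bool^d)%type) R <->
  forall a c, graph R a -> graph R c ->
    graph R [tuple tnth a i && tnth c i | i < arity R] ->
    graph R [tuple tnth a i || tnth c i | i < arity R].
Proof.
split=> [invR a c Ra Rc Rac | invR a b c d Ra Rb Rc abcd].
  apply: (invR a _ c _ Ra Rac Rc) => i.
  by rewrite !tnth_mktuple; apply/M_op_dual_boolP.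
have -> : d = [tuple tnth a i || tnth c i | i < arity R].
  apply: eq_from_tnth => i; rewrite tnth_mktuple.
  by have [] := (M_op_dual_boolP _ _ _ _).1 (abcd i).
apply: invR => //.
suff <- : b = [tuple tnth a i && tnth c i | i < arity R] by [].
apply: eq_from_tnth => i; rewrite tnth_mktuple.
by have [] := (M_op_dual_boolP _ _ _ _).1 (abcd i).
Qed.

(** Coordinates that carry a variable inherit definedness from the arguments; at those that carry a
    constant, idempotence of [f] returns that constant. *)
Lemma invariant3_instance (f : partial_op3 bool) (R : relation bool) s
    (xi : 'I_(arity R) -> 'I_s + bool) :
  (forall x, f x x x = Some x) -> invariant3 f R -> invariant3 f (instance xi).
Proof.
move=> f_idem invR a b c d Ra Rb Rc abcd.
apply: (invR _ _ _ _ Ra Rb Rc) => i.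
by rewrite !tnth_mktuple; case: (xi i).
Qed.

Lemma graph_NAND (t : 2.-tuple bool) :
  graph NAND t <-> ~~ (tnth t ord0 && tnth t ord_max).
Proof.
split=> [[[|]|] -> // |].
case: t => [[|x [|y [|]]] sz] // /=.
rewrite !(tnth_nth false) /=.
case: x y sz => [] [] sz // _; [right|left; right|left; left];
  exact: val_inj.
Qed.

Lemma NAND_not_invariant3 : ~ invariant3 (M_op (bool^d)%type) NAND.
Proof.
(* The meet of 10 and 01 is 00, which lies in [NAND]; their join 11 does not. *)
move=> /invariant3_M_op_dual_boolP
  /(_ [tuple true; false] [tuple false; true]).
rewrite !graph_NAND /= !tnth_mktuple.
by move=> /(_ isT isT isT).
Qed.

Lemma eq_NAND (g : set (2.-tuple bool)) :
  (forall t, g t <-> ~~ (tnth t ord0 && tnth t ord_max)) -> Relation g = NAND.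
Proof.
move=> gP; congr Relation; apply/funext => t; apply/propext.
by rewrite gP -graph_NAND.
Qed.

Lemma by_substitution_instance (R : relation bool) s
    (xi : 'I_(arity R) -> 'I_s + bool) :
  0 < s < arity R -> (forall v i j, xi i = inl v -> xi j = inl v -> i = j) ->
  by_substitution R (instance xi).
Proof.
move=> /andP[s_gt0 s_lt] xi_inj.
have k_bnd : 0 < arity R - s < arity R.
  by rewrite subn_gt0 s_lt ltn_subrL s_gt0 (leq_ltn_trans _ s_lt).
(* With k = [arity R - s], replacing [s] by [arity R - k] everywhere gives [xi] the type required by
   the definition, without a cast. *)
have := esym (subKn (ltnW s_lt)).
move: (arity R - s) k_bnd => k k_bnd Es; subst s.
by exists k, xi.
Qed.

Lemma by_identification_instance (R : relation bool) s
    (sigma : 'I_(arity R) -> 'I_s) :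
  0 < s < arity R -> by_identification R (instance (fun j => inl (sigma j))).
Proof.
move=> /andP[s_gt0 s_lt].
have k_bnd : 0 < arity R - s < arity R.
  by rewrite subn_gt0 s_lt ltn_subrL s_gt0 (leq_ltn_trans _ s_lt).
have := esym (subKn (ltnW s_lt)).
move: (arity R - s) k_bnd => k k_bnd Es; subst s.
by exists k, (fun j => inl (sigma j)); split=> // j; exists (sigma j).
Qed.

(** A substitution must fix at least one argument, so it cannot yield [NAND] from arity at most 2.
    Here a counterexample forces R itself to be [NAND]. *)
Lemma nand_free_join_small (R : relation bool) (a c : (arity R).-tuple bool) :
  arity R <= 2 -> nand_free R -> graph R a -> graph R c ->
  graph R [tuple tnth a i && tnth c i | i < arity R] ->
  graph R [tuple tnth a i || tnth c i | i < arity R].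
Proof.
case: R a c => r g /= a c r_le2 [R_neq _] ga gc gI.
apply: contrapT => gU.
(* Were a and c comparable, their join would be one of them and hence in R. So some i lies in a \ c
   and some j in c \ a. *)
have neq_c : [tuple tnth a i || tnth c i | i < r] <> c.
  by move=> E; rewrite E in gU.
have neq_a : [tuple tnth a i || tnth c i | i < r] <> a.
  by move=> E; rewrite E in gU.
have /existsP[i /andP[ai ci]] : [exists i, tnth a i && ~~ tnth c i].
  apply: contraT; rewrite negb_exists => /forallP le_ac.
  case: neq_c; apply: eq_from_tnth => i; rewrite tnth_mktuple.
  by have := le_ac i; case: (tnth a i); case: (tnth c i).
have /existsP[j /andP[cj aj]] : [exists i, tnth c i && ~~ tnth a i].
  apply: contraT; rewrite negb_exists => /forallP le_ca.
  case: neq_a; apply: eq_from_tnth => j; rewrite tnth_mktuple.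
  by have := le_ca j; case: (tnth a j); case: (tnth c j).
have neq_ij : i != j by apply: contraNneq aj => <-.
have r2 : r = 2.
  apply/eqP; rewrite eqn_leq r_le2 /= -[r in _ < r]card_ord.
  by rewrite (cardD1 i) (cardD1 j) !inE eq_sym neq_ij.
subst r; apply: R_neq; apply: eq_NAND => t.
have ij l : (l == i) || (l == j).
  by move: i j l neq_ij {ai ci aj cj} => [[|[|//]] ?] [[|[|//]] ?] [[|[|//]] ?].
(* The coordinates i, j are 0, 1 in one order or the other, and [NAND] is symmetric. *)
have -> : ~~ (tnth t ord0 && tnth t ord_max) = ~~ (tnth t i && tnth t j).
  move: i j neq_ij {ai ci aj cj ij} => [[|[|//]] ?] [[|[|//]] ?] //= _;
    rewrite !(tnth_nth false) //=.
  by rewrite andbC.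
have tE u : tnth u i = tnth t i -> tnth u j = tnth t j -> u = t.
  by move=> ui uj; apply: eq_from_tnth => l; have /orP[] := ij l => /eqP->.
case ti: (tnth t i); case tj: (tnth t j); split=> //= H; last first.
- suff <- : [tuple tnth a i && tnth c i | i < 2] = t by [].
  by apply: tE; rewrite tnth_mktuple ?ti ?tj ?(negbTE ci) ?(negbTE aj) ?andbF.
- suff <- : c = t by [].
  by apply: tE; rewrite ?ti ?tj ?(negbTE ci).
- suff <- : a = t by [].
  by apply: tE; rewrite ?ti ?tj ?(negbTE aj).
- case: gU; suff -> : [tuple tnth a i || tnth c i | i < 2] = t by [].
  by apply: tE; rewrite tnth_mktuple ?ti ?tj ?ai ?cj ?orbT.
Qed.

Lemma nand_free_join (R : relation bool) (a c : (arity R).-tuple bool) :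
  injective (fun i => (tnth a i, tnth c i)) ->
  nand_free R -> graph R a -> graph R c ->
  graph R [tuple tnth a i && tnth c i | i < arity R] ->
  graph R [tuple tnth a i || tnth c i | i < arity R].
Proof.
move=> ac_inj nfR Ra Rc RI.
have [r_le2|r_gt2] := leqP (arity R) 2; first exact: nand_free_join_small.
apply: contrapT => RU; case: nfR => _; apply.
(* Variable 0 stands on a \ c and variable 1 on c \ a; by [ac_inj] each occurs at most once. *)
pose xi (l : 'I_(arity R)) : 'I_2 + bool :=
  if tnth a l == tnth c l then inr (tnth a l)
  else inl (if tnth a l then ord0 else ord_max).
suff <- : instance xi = NAND.
  apply: by_substitution_instance => // v i j Ei Ej; apply: ac_inj; move: Ei Ej.
  rewrite /xi; case: (tnth a i); case: (tnth c i) => //=;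
    by case: (tnth a j); case: (tnth c j) => //= -[<-] // [].
apply: eq_NAND => t /=.
have RtE u : (forall l, tnth u l = arg_val t (xi l)) ->
    graph R [tuple arg_val t (xi j) | j < arity R] = graph R u.
  by move=> uE; congr graph; apply: eq_from_tnth => l; rewrite tnth_mktuple uE.
(* The assignments 11, 10, 01, 00 turn [xi] into a ∪ c, a, c, a ∩ c respectively. *)
case t0: (tnth t ord0); case t1: (tnth t ord_max); split=> //= H.
- case: RU; rewrite -RtE // => l; rewrite tnth_mktuple /xi.
  by case: (tnth a l); case: (tnth c l); rewrite /= ?t0 ?t1.
- rewrite (RtE a) // => l; rewrite /xi.
  by case: (tnth a l); case: (tnth c l); rewrite /= ?t0 ?t1.
- rewrite (RtE c) // => l; rewrite /xi.
  by case: (tnth a l); case: (tnth c l); rewrite /= ?t0 ?t1.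
- rewrite (RtE [tuple tnth a i && tnth c i | i < arity R]) // => l.
  rewrite tnth_mktuple /xi.
  by case: (tnth a l); case: (tnth c l); rewrite /= ?t0 ?t1.
Qed.

Lemma safely_nand_free_join (R : relation bool) (a c : (arity R).-tuple bool) :
  safely_nand_free R -> graph R a -> graph R c ->
  graph R [tuple tnth a i && tnth c i | i < arity R] ->
  graph R [tuple tnth a i || tnth c i | i < arity R].
Proof.
move=> [nfR nfR'] Ra Rc RI.
pose cls i := (tnth a i, tnth c i).
(* An identification must lose at least one variable, so the case with nothing to identify uses R
   itself. *)
have [/injectiveP cls_inj|/injectivePn[i0 [j0 neq_ij eq_cls]]] :=
    boolP (injectiveb cls); first exact: nand_free_join.
(* The new variables are the pairs (a_i, c_i) that occur, numbered by the enumeration of [S]. *)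
pose S := [set cls i | i : 'I_(arity R)].
have clsS i : cls i \in S by apply: imset_f.
pose sigma i : 'I_#|S| := enum_rank_in (clsS i0) (cls i).
have sigmaK i : enum_val (sigma i) = cls i by rewrite enum_rankK_in.
have S_bnd : 0 < #|S| < arity R.
  apply/andP; split; first by apply/card_gt0P; exists (cls i0).
  have := leq_imset_card cls 'I_(arity R); rewrite leq_eqVlt card_ord.
  rewrite -[X in _ == X]card_ord => /orP[/imset_injP cls_inj|]//.
  by case/eqP: neq_ij; apply: cls_inj.
have nfS := nfR' _ (by_identification_instance sigma S_bnd).
pose aS := [tuple (enum_val i).1 | i < #|S|].
pose cS := [tuple (enum_val i).2 | i < #|S|].
(* Tuples of R constant on the classes correspond to tuples of the instance, so a, c, their meet and
   their join all transfer. *)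
have pullE (u : #|S|.-tuple bool) (v : (arity R).-tuple bool) :
    (forall i, tnth u (sigma i) = tnth v i) ->
    graph (instance (fun j => inl (sigma j))) u = graph R v.
  move=> uv /=; congr graph; apply: eq_from_tnth => i.
  by rewrite tnth_mktuple /= uv.
rewrite -(pullE [tuple tnth aS i || tnth cS i | i < #|S|]); last first.
  by move=> i; rewrite !tnth_mktuple sigmaK.
apply: (@nand_free_join (instance (fun j => inl (sigma j)))) => //.
- move=> i j /=; rewrite !tnth_mktuple -!surjective_pairing.
  exact: enum_val_inj.
- by rewrite (pullE _ a) // => i; rewrite tnth_mktuple sigmaK.
- by rewrite (pullE _ c) // => i; rewrite tnth_mktuple sigmaK.
- rewrite (pullE _ [tuple tnth a i && tnth c i | i < arity R]) // => i.
  by rewrite !tnth_mktuple sigmaK.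
Qed.

Lemma invariant3_nand_free (R : relation bool) :
  invariant3 (M_op (bool^d)%type) R -> nand_free R.
Proof.
move=> invR; split=> [E|[k [xi [_ _ E]]]]; apply: NAND_not_invariant3.
  by rewrite -E.
by rewrite E; apply: invariant3_instance => // -[].
Qed.

(* The order on bool is false < true, so its dual bool^d is the order 1 < 0. *)
Theorem theorem40 : Gamma_SNF = Inv (M_op (bool^d)%type).
Proof.
apply/funext => R; apply/propext; split=> [snfR|invR].
  by apply/invariant3_M_op_dual_boolP => a c; apply: safely_nand_free_join.
split=> [|_ [k [xi [_ _ ->]]]]; apply: invariant3_nand_free => //.
by apply: invariant3_instance => // -[].
Qed.
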